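(* Let $\lambda\ge\kappa$ be infinite cardinals and let $B$ be a boolean algebra with the $(\lambda,\kappa)$-FN. Then the exponential $\exp(B)$ also has the $(\lambda,\kappa)$-FN.
   Context: For infinite cardinals $\lambda\ge\kappa$, a partial order $P$ has the $(\lambda,\kappa)$-FN iff there is a map $(f,g)\colon P\to[P]^{<\lambda}\times[P]^{<\kappa}$ such that for all $p\le q$ in $P$ there exist $r\in f(p)\cap g(q)$ with $p\le r\le q$ and $s\in g(p)\cap f(q)$ with $p\le s\le q$. Here $[P]^{<\mu}$ is the set of subsets of $P$ of cardinality less than $\mu$. A boolean algebra has the $(\lambda,\kappa)$-FN iff its underlying partial order does. For a boolean algebra $B$ with Stone space $\mathrm{Ult}(B)$, the exponential $\exp(B)$ is the algebra of clopen subsets of the Vietoris hyperspace $2^{\mathrm{Ult}(B)}$ of nonempty closed subsets of $\mathrm{Ult}(B)$. Equivalently, $\exp(B)$ is the boolean algebra freely generated by symbols $[a]$ ($a\in B$) modulo the relations $[0]=0$, $[1]=1$, $[a]\le[b]$ whenever $a\le b$, and $[a]\wedge[b]=[a\wedge b]$. *)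

(* Defs.v *)
From HB Require Import structures.
From mathcomp Require Import all_boot all_order.
From mathcomp Require Import boolp classical_sets functions cardinality.
From mathcomp Require Import topology.

Set Implicit Arguments.
Unset Strict Implicit.
Unset Printing Implicit Defensive.

Import Order.TTheory.

Local Open Scope classical_set_scope.
Local Open Scope card_scope.

(* Cardinals are represented by types: the type [lambda] stands for the
   cardinality of [[set: lambda]]. *)

Definition card_lt T U (A : set T) (B : set U) : Prop :=
  A #<= B /\ ~ (B #<= A).

Definition has_FN (lambda kappa : Type) d (P : porderType d) : Prop :=
  exists f g : P -> set P,
    [/\ forall p, card_lt (f p) [set: lambda],
        forall p, card_lt (g p) [set: kappa] &
        forall p q : P, (p <= q)%O ->
          (exists2 r, (f p `&` g q) r & (p <= r <= q)%O) /\
          (exists2 s, (g p `&` f q) s & (p <= s <= q)%O)].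

(* Boolean algebras are [ctbDistrLatticeType]s; the degenerate algebra, in
   which [\bot = \top], is allowed, and it has no ultrafilter. *)

Section StoneSpace.
Context {d : Order.disp_t} (B : ctbDistrLatticeType d).

Definition proper_filter (F : set B) : Prop :=
  [/\ F \top%O, ~ F \bot%O,
      forall a b, F a -> F b -> F (a `&` b)%O &
      forall a b, (a <= b)%O -> F a -> F b].

Definition is_ultrafilter (F : set B) : Prop :=
  proper_filter F /\ forall G, proper_filter G -> F `<=` G -> G = F.

Record Ult := MkUlt {
  ult_set :> set B;
  _ : `[< is_ultrafilter ult_set >] }.

HB.instance Definition _ := [isSub for ult_set].
HB.instance Definition _ := [Choice of Ult by <:].

Lemma UltP (u : Ult) : is_ultrafilter u.
Proof. by case: u => F /= /asboolP. Qed.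

Definition stone_set (a : B) : set Ult := [set u : Ult | ult_set u a].

Let stone_cover : \bigcup_(U in range stone_set) U = setT.
Proof.
apply/seteqP; split=> // u _; exists (stone_set \top%O); first by exists \top%O.
by have [[]] := UltP u.
Qed.

Let stone_join (U V : set Ult) (u : Ult) :
  range stone_set U -> range stone_set V -> U u -> V u ->
  exists W, [/\ range stone_set W, W u & W `<=` U `&` V].
Proof.
move=> [a _ <-] [b _ <-] ua ub; exists (stone_set (a `&` b)%O); split.
- by exists (a `&` b)%O.
- by have [[_ _ uI _] _] := UltP u; exact: uI.
- move=> v vab; have [[_ _ _ vS] _] := UltP v.
  by split; apply: vS vab; rewrite ?leIl ?leIr.
Qed.

HB.instance Definition _ :=
  @isBaseTopological.Build Ult _ (range stone_set) id stone_cover stone_join.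

End StoneSpace.

Section Hyperspace.
Context (X : topologicalType).

Record hyperspace := MkHyperspace {
  hyper_set :> set X;
  _ : `[< closed hyper_set /\ hyper_set !=set0 >] }.

HB.instance Definition _ := [isSub for hyper_set].
HB.instance Definition _ := [Choice of hyperspace by <:].

Definition vietoris_box (U : set X) : set hyperspace :=
  [set F : hyperspace | F `<=` U].

Definition vietoris_diamond (U : set X) : set hyperspace :=
  [set F : hyperspace | F `&` U !=set0].

Definition vietoris_subbase : set (set hyperspace) :=
  [set vietoris_box U | U in open] `|` [set vietoris_diamond U | U in open].

HB.instance Definition _ :=
  isSubBaseTopological.Build hyperspace vietoris_subbase id.

End Hyperspace.

Section ClopenAlgebra.
Context (X : topologicalType).

Definition clopen_pred : pred (set X) := fun A => `[< clopen A >].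

Record Clop := MkClop { clop_set :> set X; _ : clopen_pred clop_set }.

HB.instance Definition _ := [isSub for clop_set].
HB.instance Definition _ := [Choice of Clop by <:].

Let clopen_predI :
  {in clopen_pred &, forall A B : set X, (A `&` B)%O \in clopen_pred}.
Proof. by move=> A B /asboolP ? /asboolP ?; apply/asboolP; exact: clopenI. Qed.

Let clopen_predU :
  {in clopen_pred &, forall A B : set X, (A `|` B)%O \in clopen_pred}.
Proof. by move=> A B /asboolP ? /asboolP ?; apply/asboolP; exact: clopenU. Qed.

Let clopen_pred0 : (\bot%O : set X) \in clopen_pred.
Proof. by apply/asboolP; exact: clopen0. Qed.

Let clopen_pred1 : (\top%O : set X) \in clopen_pred.
Proof. by apply/asboolP; exact: clopenT. Qed.

HB.instance Definition _ := Order.SubChoice_isTBSubLattice.Build _ (set X)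
  clopen_pred set_display Clop clopen_predI clopen_predU
  clopen_pred0 clopen_pred1.

Let Clop_meetUl : @left_distributive Clop Clop Order.meet Order.join.
Proof. by move=> A B C; apply: val_inj; exact: setIUl. Qed.

HB.instance Definition _ :=
  Order.Lattice_Meet_isDistrLattice.Build set_display Clop Clop_meetUl.

Let clopen_predC (A : Clop) : clopen_pred (~` A).
Proof. by case: A => A /= /asboolP cA; apply/asboolP; exact: clopenC. Qed.

Definition Clop_compl (A : Clop) : Clop := MkClop (clopen_predC A).

Let Clop_joinC (A : Clop) : (A `|` Clop_compl A)%O = \top%O.
Proof. by apply: val_inj; exact: setUv. Qed.

Let Clop_meetC (A : Clop) : (A `&` Clop_compl A)%O = \bot%O.
Proof. by apply: val_inj; exact: setICr. Qed.

HB.instance Definition _ := Order.TBDistrLattice_hasComplement.Build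
  set_display Clop Clop_joinC Clop_meetC.

End ClopenAlgebra.

Definition exponential d (B : ctbDistrLatticeType d) :
  ctbDistrLatticeType set_display := Clop (hyperspace (Ult B)).

(* Main.v *)
(* The elements [a] of exp(B) are the boxes {F | F <= a}, and the diamonds are
   {F | F meets a}. By compactness of the Vietoris space every p in exp(B) is a
   finite join of clauses, i.e. of meets of one box with finitely many diamonds;
   dually, q is a finite meet of complements of clauses. If p <= q, each clause
   c of p is disjoint from each clause c' of ~q, and testing the closed set
   a /\ a' (the intersection of their box parts) shows that this disjointness is
   already witnessed by a single inequality x <= ~y in B between labels of c and
   c'. An interpolant r of x <= ~y then gives the interpolant box r or diamond r
   of c <= ~c', and the join over c of the meets over c' interpolates p <= q.
   Hence f can be extended to exp(B) by letting f'(p) consist of the finite joins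
   of finite meets of boxes and diamonds of members of f(t), where t ranges over
   the finitely many labels of p. Passing to such a closure keeps cardinalities
   below any infinite cardinal, singular or not, because |A * A| = |A| for
   infinite A. *)
Require Import Defs.
From mathcomp Require Import all_boot all_order.
From mathcomp Require Import boolp classical_sets functions cardinality.
From mathcomp Require Import topology.

Set Implicit Arguments.
Unset Strict Implicit.
Unset Printing Implicit Defensive.

Import Order.Theory.

Local Open Scope classical_set_scope.
Local Open Scope card_scope.

(** * Cardinalities *)

Lemma card_le_inj T U (A : set T) (B : set U) (f : T -> U) :
  (forall x, A x -> B (f x)) ->
  (forall x y, A x -> A y -> f x = f y -> x = y) -> A #<= B.
Proof.
move=> fAB fI; have /injfunPex[g] : exists2 g : T -> U, set_fun A B g & set_inj A g.
  by exists f => // x y /set_mem Ax /set_mem Ay; exact: fI.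
exact: inj_card_le.
Qed.

Lemma card_le_choice T U (A : set T) (B : set U) (R : T -> U -> Prop) :
  (forall x, A x -> exists2 y, B y & R x y) ->
  (forall x x' y, A x -> A x' -> R x y -> R x' y -> x = x') -> A #<= B.
Proof.
move=> RAB RI; have [[a Aa]|/set0P/negP/negPn/eqP->] := pselect (A !=set0);
  last exact: card_ge0.
have [u0 _ _] := RAB _ Aa.
have /choice[f fP] : forall x, exists y, A x -> B y /\ R x y.
  move=> x; have [/RAB[y By Rxy]|nAx] := pselect (A x); first by exists y.
  by exists u0.
apply: (@card_le_inj _ _ _ _ f) => [x /fP[]//|x y Ax Ay fxy].
apply: (RI _ _ (f x)) => //; first exact: (fP _ Ax).2.
by rewrite fxy; exact: (fP _ Ay).2.
Qed.

Lemma card_le_funP T (x0 : T) U (A : set U) (B : set T) : A #<= B ->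
  exists2 f : U -> T, (forall x, A x -> B (f x)) &
    (forall x y, A x -> A y -> f x = f y -> x = y).
Proof.
elim/Ppointed: T => T in x0 B *; first by have := no x0.
move=> /pcard_leP/injfunPex[f fAB fI]; exists f => // x y Ax Ay.
by apply: fI; rewrite inE.
Qed.

(** Zorn's lemma gives a maximal graph of a partial injection from [A] to [B]; if it missed points
    on both sides, matching two of them would enlarge it. *)
Lemma card_le_total T U (A : set T) (B : set U) : A #<= B \/ B #<= A.
Proof.
pose P (R : set (T * U)) := [/\ (forall x y, R (x, y) -> A x /\ B y),
  (forall x y y', R (x, y) -> R (x, y') -> y = y') &
  (forall x x' y, R (x, y) -> R (x', y) -> x = x')].
have [F FP Ftot|R [[RAB Rf RI] Rmax]] := @Zorn_bigcup _ P.
  split=> [x y [R /FP[RAB _ _]]|x y y' [R FR Rxy] [R' FR' R'xy]|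
           x x' y [R FR Rxy] [R' FR' R'xy]]; first exact: RAB.
    have [sRR|sRR] := Ftot _ _ FR FR'.
      by have [_ + _] := FP _ FR'; apply; [apply: sRR; exact: Rxy|].
    by have [_ + _] := FP _ FR; apply; [exact: Rxy|exact: sRR].
  have [sRR|sRR] := Ftot _ _ FR FR'.
    by have [_ _] := FP _ FR'; apply; [apply: sRR; exact: Rxy|].
  by have [_ _] := FP _ FR; apply; [exact: Rxy|exact: sRR].
have [Atot|] := pselect (forall x, A x -> exists y, R (x, y)).
  left; apply: (@card_le_choice _ _ _ _ (fun x y => R (x, y))) => [x /Atot[y Rxy]|x x' y _ _].
    by exists y => //; have [] := RAB _ _ Rxy.
  exact: RI.
move=> /existsNP[a /not_implyP[Aa /forallNP nR]].
right; apply: (@card_le_choice _ _ _ _ (fun y x => R (x, y))) => [b Bb|y y' x _ _]; last exact: Rf.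
suff [x Rxb] : exists x, R (x, b) by exists x => //; have [] := RAB _ _ Rxb.
apply/not_existsP => nRb; apply: (Rmax (R `|` [set (a, b)])).
  by rewrite properEneq; split; [|exact: subsetUl]; apply/eqP => RE; apply: (nR b); rewrite RE; right.
split=> [x y [/RAB//|[-> ->]]//|x y y'|x x' y].
  move=> [Rxy|[xa yb]] [Rxy'|[xa' yb']]; first exact: Rf Rxy Rxy'.
  - by case: (nR y); rewrite -xa'.
  - by case: (nR y'); rewrite -xa.
  - by rewrite yb yb'.
move=> [Rxy|[xa yb]] [Rxy'|[xa' yb']]; first exact: RI Rxy Rxy'.
- by case: (nRb x); rewrite -yb'.
- by case: (nRb x'); rewrite -yb.
- by rewrite xa xa'.
Qed.

(** * Infinite sets absorb their squares *)

Section square.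
Context {T : Type} (A : set T).

(* A pairing is the graph of an injection [D `*` D -> D], [D `<=` A]; [D] can be
   read off the graph, so that pairings are ordered by inclusion of graphs. *)
Definition pairing_dom (R : set (T * T * T)) : set T :=
  [set x | exists y, R (x, x, y)].

Definition pairing (R : set (T * T * T)) : Prop :=
  [/\ pairing_dom R `<=` A,
      (forall x y z, R (x, y, z) ->
        [/\ pairing_dom R x, pairing_dom R y & pairing_dom R z]),
      (forall x y, pairing_dom R x -> pairing_dom R y -> exists z, R (x, y, z)),
      (forall x y z z', R (x, y, z) -> R (x, y, z') -> z = z') &
      (forall x y x' y' z, R (x, y, z) -> R (x', y', z) -> x = x' /\ y = y')].

(** The chain condition for Zorn's lemma: each clause of [pairing] involves at most two triples or
    domain points, and one member of the chain contains both. *)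
Lemma pairing_bigcup (F : set (set (T * T * T))) :
  (forall R, F R -> pairing R) -> total_on F subset ->
  pairing (\bigcup_(R in F) R).
Proof.
move=> FP Ftot.
have dir R R' : F R -> F R' -> exists2 S, F S & R `<=` S /\ R' `<=` S.
  by move=> FR FR'; have [s|s] := Ftot _ _ FR FR';
    [exists R' => //; split|exists R => //; split].
have sub R : F R -> pairing_dom R `<=` pairing_dom (\bigcup_(R in F) R).
  by move=> FR x [y Rx]; exists y, R.
split.
- by move=> x [y [R FR Rxx]]; have [+ _ _ _ _] := FP _ FR; apply; exists y.
- move=> x y z [R FR Rxyz]; have [_ + _ _ _] := FP _ FR.
  by move=> /(_ _ _ _ Rxyz)[Dx Dy Dz]; split; exact: (sub _ FR).
- move=> x y [x' [R FR Rx]] [y' [R' FR' Ry]].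
  have [S FS [RS R'S]] := dir _ _ FR FR'; have [_ _ + _ _] := FP _ FS.
  move=> /(_ x y)[||z Sxyz]; [by exists x'; exact: RS|by exists y'; exact: R'S|].
  by exists z, S.
- move=> x y z z' [R FR Rx] [R' FR' Ry].
  have [S FS [RS R'S]] := dir _ _ FR FR'; have [_ _ _ + _] := FP _ FS.
  by apply; [exact: RS Rx|exact: R'S].
- move=> x y x' y' z [R FR Rx] [R' FR' Ry].
  have [S FS [RS R'S]] := dir _ _ FR FR'; have [_ _ _ _] := FP _ FS.
  by apply; [exact: RS Rx|exact: R'S].
Qed.

Lemma pairing_nat : infinite_set A ->
  exists2 R, pairing R & infinite_set (pairing_dom R).
Proof.
move=> Ainf; have [a _] := infinite_setN0 Ainf.
have /(card_le_funP a)[i iA iI] : [set: nat] #<= A by apply/infiniteP.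
have /(card_le_funP 0%N)[k _ kI] : [set: nat * nat] #<= [set: nat].
  by have := card_nat2; rewrite card_eqPle => -[].
exists [set t | exists m n, t = (i m, i n, i (k (m, n)))].
  have dom n : pairing_dom [set t | exists m n, t = (i m, i n, i (k (m, n)))] (i n).
    by exists (i (k (n, n))), n, n.
  split=> [x [_ [m [_ [-> _ _]]]]|x y z [m [n [-> -> ->]]]|x y [_ [m [n [-> _ _]]]] [_ [m' [n' [-> _ _]]]]|
    x y z z' [m [n [-> -> ->]]] [m' [n' [/iI -> // /iI-> // ->]]]//|
    x y x' y' z [m [n [-> -> ->]]] [m' [n' [-> -> ]]]].
  - exact: iA.
  - by [].
  - by exists (i (k (m, m'))), m, m'.
  - by move=> /iI => /(_ I I) /kI => /(_ I I)[-> ->].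
apply/infiniteP; apply: (@card_le_inj _ _ _ _ i) => [n _|m n _ _]; last exact: iI.
by exists (i (k (n, n))), n, n.
Qed.

(** The domain [D] of a maximal pairing absorbs its own square; either [A] embeds in [D], which
    gives the claim, or the pairing can be enlarged. *)
Lemma card_le_square : infinite_set A -> A `*` A #<= A.
Proof.
move=> /pairing_nat[R0 R0P R0inf].
(* Maximality is sought above [R0] because a maximal pairing could otherwise have
   a domain with at most one point. *)
pose P (X : set (T * T * T)) := pairing (R0 `|` X).
have [F FP Ftot|X [RP Xmax]] := @Zorn_bigcup _ P.
  have [[X0 FX0]|/set0P/negP/negPn/eqP F0] := pselect (F !=set0); last first.
    by rewrite F0 bigcup_set0 /P setU0.
  rewrite /P -bigcupUr; last by exists X0.
  rewrite -(bigcup_image F (fun X => R0 `|` X) id).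
  apply: pairing_bigcup => [_ [X FX <-]|_ _ [X FX <-] [Y FY <-]]; first exact: FP.
  by have [XY|YX] := Ftot _ _ FX FY; [left|right]; apply: setUS.
rewrite /P in RP Xmax; set R := R0 `|` X in RP Xmax.
have [RA Rsub Rtot Rf RI] := RP.
set D := pairing_dom R.
have DA : D `<=` A by [].
have Dinf : infinite_set D.
  by apply: (sub_infinite_set _ R0inf) => x [y Ry]; exists y; left.
have [a Da] := infinite_setN0 Dinf.
(* The tags [a] and [b] as second coordinates give two disjoint copies of [D] inside [D]. *)
have [b Db ab] : exists2 b, D b & a <> b.
  apply: contrapT => nb; apply: Dinf; apply: (@sub_finite_set _ _ [set a]); last exact: finite_set1.
  by move=> b Db; apply: contrapT => ba; apply: nb; exists b => // /esym.
have /choice[r rP] : forall t : T * T, exists z, D t.1 -> D t.2 -> R (t, z).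
  move=> [x y]; have [[Dx Dy]|nD] := pselect (D x /\ D y).
    by have [z Rz] := Rtot _ _ Dx Dy; exists z.
  by exists a => Dx Dy; case: nD.
have rD x y : D x -> D y -> D (r (x, y)).
  by move=> Dx Dy; have /Rsub[] := rP (x, y) Dx Dy.
have rI x y x' y' : D x -> D y -> D x' -> D y' -> r (x, y) = r (x', y') -> x = x' /\ y = y'.
  move=> Dx Dy Dx' Dy' rE; apply: RI (rP (x, y) Dx Dy) _.
  by rewrite rE; exact: (rP (x', y')).
have [ADD|] := card_le_total (A `\` D) D.
  have [j jD jI] := card_le_funP a ADD.
  pose c x := if `[< D x >] then r (x, a) else r (j x, b).
  have cD x : A x -> D (c x).
    rewrite /c; case: asboolP => Dx Ax; apply: rD => //.
    exact: jD.
  have cI x y : A x -> A y -> c x = c y -> x = y.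
    rewrite /c => Ax Ay; case: asboolP => Dx; case: asboolP => Dy rE.
    - by have [] := rI _ _ _ _ Dx Da Dy Da rE.
    - by have [_ /ab] := rI _ _ _ _ Dx Da (jD y (conj Ay Dy)) Db rE.
    - by have [_ /esym/ab] := rI _ _ _ _ (jD x (conj Ax Dx)) Db Dy Da rE.
    - have [jE _] := rI _ _ _ _ (jD x (conj Ax Dx)) Db (jD y (conj Ay Dy)) Db rE.
      exact: jI jE.
  apply: (@card_le_inj _ _ _ _ (fun t => r (c t.1, c t.2))) => [[x y] [/= Ax Ay]|
    [x y] [x' y'] [/= Ax Ay] [/= Ax' Ay'] ].
    by apply/DA/rD; exact: cD.
  move=> /rI[|||| /cI-> // /cI-> //]; exact: cD.
(* Otherwise [j] copies [D] onto [E], disjoint from [D], and the new pairs of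
   [D `|` E] can be paired injectively into [E]: a contradiction. *)
move=> /(card_le_funP a)[j jD jI].
have jND x : D x -> ~ D (j x) by move=> /jD[].
have jA x : D x -> A (j x) by move=> /jD[].
pose E := j @` D; exfalso.
(* [c] embeds the union of [D] and [E] in [D]: tag [a] on [D], tag [b] on [E] after pulling back
   along [j]. *)
have /choice[c cP] : forall x, exists y, [/\ (D x -> y = r (x, a)) &
    (E x -> exists z, [/\ D z, j z = x & y = r (z, b)])].
  move=> x; have [Dx|nDx] := pselect (D x).
    by exists (r (x, a)); split=> // -[z /jND nDz zx]; case: nDz; rewrite zx.
  have [[z Dz <-]|nEx] := pselect (E x); last by exists a.
  exists (r (z, b)); split=> [Djz|_]; by [case: (jND _ Dz)|exists z].
have cD x : (D `|` E) x -> D (c x).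
  have [cx1 cx2] := cP x; move=> [Dx|/cx2[z [Dz _ ->]]]; last exact: rD.
  by rewrite cx1 //; apply: rD.
have cI x y : (D `|` E) x -> (D `|` E) y -> c x = c y -> x = y.
  have [cx1 cx2] := cP x; have [cy1 cy2] := cP y.
  move=> [Dx|/cx2[z [Dz <- ->]]] [Dy|/cy2[z' [Dz' <- ->]]]; rewrite ?cx1 ?cy1//.
  - by move=> /rI[].
  - by move=> /rI[].
  - by move=> /rI[//|//|//|//|_ /esym].
  - by move=> /rI[//|//|//|//|-> _].
(* [Y] codes exactly the pairs not inside [D]; its values lie in [E], so they never clash with those
   of [R], which lie in [D]. *)
pose Y := [set t : T * T * T | [/\ (D `|` E) t.1.1, (D `|` E) t.1.2,
   ~ (D t.1.1 /\ D t.1.2) & t.2 = j (r (c t.1.1, c t.1.2))]].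
have RYE : R0 `|` (X `|` Y) = R `|` Y by rewrite setUA.
have YD x y z : Y (x, y, z) -> D (r (c x, c y)) by move=> [/= xDE yDE _ _]; apply: rD; exact: cD.
have YE x y z : Y (x, y, z) -> E z by move=> /[dup] /YD ? [_ _ _ /= ->]; exists (r (c x, c y)).
have domU : pairing_dom (R `|` Y) = D `|` E.
  apply/seteqP; split=> x.
    by move=> [z [Rx|[/=]//]]; left; exists z.
  move=> [[z Rx]|Ex]; first by exists z; left.
  exists (j (r (c x, c x))); right; split; [by right|by right| |by []].
  by move=> [Dx _]; have [z /jND + zx] := Ex; rewrite zx.
apply: (Xmax (X `|` Y)).
  rewrite properEneq; split; last exact: subsetUl.
  apply/eqP => XE; have : Y (j a, j a, j (r (c (j a), c (j a)))).
    have Eja : E (j a) by exists a.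
    by split; [right|right|move=> [/(jND _ Da)]|].
  move=> Ya; have : R (j a, j a, j (r (c (j a), c (j a)))).
    by right; rewrite XE; right.
  by move=> /Rsub[/(jND _ Da)].
rewrite RYE; split; rewrite ?domU.
- have EA : E `<=` A by move=> _ [z /jA ? <-].
  by move=> x [/DA|/EA].
- move=> x y z [/Rsub[Dx Dy Dz]|Yx]; first by split; left.
  by have Ez := YE _ _ _ Yx; have [/= xDE yDE _ _] := Yx; split=> //; right.
- move=> x y xDE yDE; have [[Dx Dy]|nD] := pselect (D x /\ D y).
    by have [z Rz] := Rtot _ _ Dx Dy; exists z; left.
  by exists (j (r (c x, c y))); right.
- move=> x y z z' [Rx|[_ _ /= nD zE]] [Rx'|[_ _ /= nD' zE']].
  + exact: Rf Rx Rx'.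
  + by case: nD'; have [] := Rsub _ _ _ Rx.
  + by case: nD; have [] := Rsub _ _ _ Rx'.
  + by rewrite zE zE'.
- move=> x y x' y' z [Rx|Yx] [Rx'|Yx'].
  + exact: RI Rx Rx'.
  + have [_ _ Dz] := Rsub _ _ _ Rx.
    by have [w /jND + wz] := YE _ _ _ Yx'; rewrite wz.
  + have [_ _ Dz] := Rsub _ _ _ Rx'.
    by have [w /jND + wz] := YE _ _ _ Yx; rewrite wz.
  + have YDx := YD _ _ _ Yx; have YDx' := YD _ _ _ Yx'.
    move: Yx Yx' => [/= xDE yDE _ ->] [/= xDE' yDE' _] /jI => /(_ YDx YDx').
    by move=> /rI[|||| /cI-> // /cI-> //]; exact: cD.
Qed.

End square.

Lemma card_le_setU T U (A B : set T) (C : set U) : infinite_set C ->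
  A #<= C -> B #<= C -> A `|` B #<= C.
Proof.
move=> Cinf; have [c Cc] := infinite_setN0 Cinf.
move=> /(card_le_funP c)[f fC fI] /(card_le_funP c)[g gC gI].
have [c' Cc' cc'] : exists2 c', C c' & c <> c'.
  apply: contrapT => nb; apply: Cinf; apply: (@sub_finite_set _ _ [set c]); last exact: finite_set1.
  by move=> b Cb; apply: contrapT => bc; apply: nb; exists b => // /esym.
apply: card_le_trans (card_le_square Cinf).
apply: (@card_le_inj _ _ _ _ (fun x => if `[< A x >] then (c, f x) else (c', g x))).
  by move=> x ABx; case: asboolP => Ax; split => //=; [exact: fC|case: ABx => // /gC].
move=> x y ABx ABy; case: asboolP => Ax; case: asboolP => Ay // [] //; first exact: fI.
  by move=> /esym.
by apply: gI; [case: ABx|case: ABy].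
Qed.

(** * Sets smaller than a fixed infinite cardinal *)

Section card_lt.
Context {V : Type}.
Hypothesis Vinf : infinite_set [set: V].

Lemma card_ltP T (A : set T) : card_lt A [set: V] <-> ~ ([set: V] #<= A).
Proof.
by split=> [[]//|nVA]; split=> //; have [//|/nVA] := card_le_total A [set: V].
Qed.

Lemma card_lt_le T U (A : set T) (B : set U) : A #<= B ->
  card_lt B [set: V] -> card_lt A [set: V].
Proof. by move=> AB /card_ltP nVB; apply/card_ltP => /card_le_trans/(_ AB). Qed.

Lemma card_lt_finite T (A : set T) : finite_set A -> card_lt A [set: V].
Proof.
by move=> Afin; apply/card_ltP => /card_le_finite/(_ Afin).
Qed.

(** Comparability makes [B] the larger set; an infinite [B] absorbs [A], and for finite [B] the
    union is finite. *)
Lemma card_lt_setU T (A B : set T) : card_lt A [set: V] ->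
  card_lt B [set: V] -> card_lt (A `|` B) [set: V].
Proof.
wlog AB : A B / A #<= B.
  by move=> wl Alt Blt; have [/wl|/wl] := card_le_total A B; last rewrite setUC; exact.
move=> Alt Blt; have [Bfin|Binf] := pselect (finite_set B).
  by apply: card_lt_finite; rewrite finite_setU; split=> //; exact: card_le_finite AB Bfin.
by apply: card_lt_le Blt; exact: card_le_setU.
Qed.

Lemma card_lt_bigcup (I : eqType) T (s : seq I) (F : I -> set T) :
  (forall i, card_lt (F i) [set: V]) ->
  card_lt (\bigcup_(i in [set` s]) F i) [set: V].
Proof.
move=> Flt; elim: s => [|i s IH].
  by rewrite set_nil bigcup_set0; exact/card_lt_finite/finite_set0.
have -> : [set` i :: s] = i |` [set` s].
  by apply/seteqP; split=> j /=; rewrite inE => /predU1P.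
by rewrite bigcup_setU1; exact: card_lt_setU.
Qed.

End card_lt.

Definition seqs (T : eqType) (A : set T) : set (seq T) :=
  [set s | [set` s] `<=` A].

Lemma seqs_card_le (T : eqType) (A : set T) : infinite_set A -> seqs A #<= A.
Proof.
move=> Ainf; have [a Aa] := infinite_setN0 Ainf.
have /(card_le_funP a)[r rA rI] := card_le_square Ainf.
have /(card_le_funP a)[i iA iI] : [set: nat] #<= A by apply/infiniteP.
pose c := foldr (fun x y => r (x, y)) a.
have cA s : seqs A s -> A (c s).
  elim: s => //= x s IH sA; apply: rA; split=> /=.
    by apply: sA; rewrite /= inE eqxx.
  by apply: IH => y ys; apply: sA; rewrite /= inE; apply/orP; right.
have cI s s' : seqs A s -> seqs A s' -> size s = size s' -> c s = c s' -> s = s'.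
  elim: s s' => [|x s IH] [|x' s'] //= sA sA' [ss'].
  have sA1 : seqs A s by move=> y ys; apply: sA; rewrite /= inE; apply/orP; right.
  have sA1' : seqs A s' by move=> y ys; apply: sA'; rewrite /= inE; apply/orP; right.
  have Ax : A x by apply: sA; rewrite /= inE eqxx.
  have Ax' : A x' by apply: sA'; rewrite /= inE eqxx.
  have As : (A `*` A) (x, c s) by split=> //; exact: cA.
  have As' : (A `*` A) (x', c s') by split=> //; exact: cA.
  by move=> cc; have [-> /IH->] := rI _ _ As As' cc.
(* The length is part of the code because the end marker [a] may itself be the code of a pair. *)
apply: (@card_le_inj _ _ _ _ (fun s => r (i (size s), c s))) => [s sA|s s' sA sA'].
  by apply: rA; split; [exact: iA|exact: cA].
have As : (A `*` A) (i (size s), c s) by split; [exact: iA|exact: cA].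
have As' : (A `*` A) (i (size s'), c s') by split; [exact: iA|exact: cA].
by move=> cc; have [/iI ss /cI] := rI _ _ As As' cc; apply=> //; exact: ss.
Qed.

(** A finite nonempty [A] has infinitely many lists, too many when [V] is countable; but [h] sees
    only the members of a list, so its image is then finite. *)
Lemma card_lt_seqs (V T : Type) (E : eqType) (A : set E) (h : seq E -> T) :
  infinite_set [set: V] -> (forall s s', s =i s' -> h s = h s') ->
  card_lt A [set: V] -> card_lt (h @` seqs A) [set: V].
Proof.
move=> Vinf hE Alt; have [/finite_seqP[e eA]|Ainf] := pselect (finite_set A); last first.
  by apply: card_lt_le Alt => //; apply: card_le_trans (seqs_card_le Ainf); exact: card_image_le.
apply: card_lt_finite => //; apply: (@sub_finite_set _ _
    [set h (mask (val m) e) | m in [set: (size e).-tuple bool]]).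
  move=> _ [s sA <-]; exists (map_tuple (mem s) (in_tuple e)) => //=.
  rewrite -filter_mask; apply: hE => x; rewrite mem_filter.
  apply/andP/idP => [[]//|xs]; split=> //.
  by have := sA _ xs; rewrite eA.
exact/finite_image/finite_finset.
Qed.

(** * Ultrafilters and Stone spaces *)

Section Stone.
Context {d : Order.disp_t} (B : ctbDistrLatticeType d).
Implicit Types (a b : B) (u : Ult B).

(** Zorn's lemma is applied to the sets [X] added to [F], so that the empty chain is bounded by [F]
    itself. *)
Lemma proper_filter_extend (F : set B) : proper_filter F ->
  exists u : Ult B, F `<=` u.
Proof.
move=> FP; pose P (X : set B) := proper_filter (F `|` X).
have [C CP Ctot|X [XP Xmax]] := @Zorn_bigcup _ P.
  have [[X0 CX0]|/set0P/negP/negPn/eqP C0] := pselect (C !=set0); last first.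
    by rewrite C0 bigcup_set0 /P setU0.
  have sub X x : C X -> (F `|` X) x -> (F `|` \bigcup_(X in C) X) x.
    by move=> CX [Fx|Xx]; [left|right; exists X].
  have lift x : (F `|` \bigcup_(X in C) X) x -> exists2 X, C X & (F `|` X) x.
    by move=> [Fx|[X CX Xx]]; [exists X0|exists X] => //; [left|right].
  split=> [|/lift[X /CP[]//]|x y /lift[X CX Xx] /lift[Y CY Yy]|
           x y xy /lift[X CX Xx]].
  - by apply: (sub X0) => //; have [] := CP _ CX0.
  - have [XY|YX] := Ctot _ _ CX CY.
      apply: (sub Y) => //; have [_ _ + _] := CP _ CY; apply=> //.
      by case: Xx; [left|right; exact: XY].
    apply: (sub X) => //; have [_ _ + _] := CP _ CX; apply=> //.
    by case: Yy; [left|right; exact: YX].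
  - by apply: (sub X) => //; have [_ _ _] := CP _ CX; apply; first exact: xy.
have uP : is_ultrafilter (F `|` X).
  split=> // G GP FXG.
  have GE : F `|` G = G by apply/setUidr => x Fx; apply: FXG; left.
  have [XG|/contrapT XG] := pselect (~ (G `<=` X)).
    exfalso; apply: (Xmax G); last by rewrite /P GE.
    by split=> // x Xx; apply: FXG; right.
  by apply/seteqP; split=> // x /XG; right.
by exists (MkUlt (asboolT uP)) => x Fx; left.
Qed.

Lemma ultT u : ult_set u \top%O.
Proof. by have [[]] := UltP u. Qed.

Lemma ult0 u : ~ ult_set u \bot%O.
Proof. by have [[]] := UltP u. Qed.

Lemma ultS u a b : (a <= b)%O -> ult_set u a -> ult_set u b.
Proof. by have [[_ _ _ uS] _] := UltP u; exact: uS. Qed.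

Lemma ultI u a b : ult_set u (a `&` b)%O <-> ult_set u a /\ ult_set u b.
Proof.
split=> [uab|[]]; last by have [[_ _ + _] _] := UltP u; apply.
by split; apply: ultS uab; rewrite ?leIl ?leIr.
Qed.

Lemma ultC u a : ult_set u (~` a)%O <-> ~ ult_set u a.
Proof.
split=> [una ua|nua].
  by apply: (@ult0 u); rewrite -(meetxC a); apply/ultI.
(* As [a] is not in [u], this is a proper filter above [u]; maximality makes it equal to [u], and it
   contains the complement of [a]. *)
pose G := [set x | ult_set u (a `|` x)%O].
have uG : ult_set u `<=` G by move=> x; apply: ultS; rewrite leUr.
have GP : proper_filter G.
  split=> [|/=|x y Gx Gy|x y xy] /=; first by rewrite /G /= joinx1; exact: ultT.
  - by rewrite /G /= joinx0.
  - by rewrite /G /= joinIr; apply/ultI.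
  - by rewrite /G /=; apply: ultS; exact: leU2.
have [_ /(_ _ GP uG) <-] := UltP u.
by rewrite /G /= joinxC; exact: ultT.
Qed.

Lemma ultU u a b : ult_set u (a `|` b)%O <-> ult_set u a \/ ult_set u b.
Proof.
split=> [uab|[]]; last 2 first.
- by apply: ultS; rewrite leUl.
- by apply: ultS; rewrite leUr.
have [|/ultC una] := pselect (ult_set u a); first by left.
right; have : ult_set u ((a `|` b) `&` ~` a)%O by apply/ultI.
by apply: ultS; rewrite meetUl meetxC join0x leIl.
Qed.

Definition ideal (I : set B) := [/\ I \bot%O,
  forall a b, I a -> I b -> I (a `|` b)%O & forall a b, (a <= b)%O -> I b -> I a].

Lemma filter_ideal_separation (F I : set B) : proper_filter F -> ideal I ->
  F `&` I = set0 -> exists2 u : Ult B, F `<=` u & ult_set u `&` I = set0.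
Proof.
move=> [FT F0 FI FS] [I0 IU IS] FI0.
(* The inequality says that [a] minus [b] is below [x]: this is the filter generated by [F] and the
   complements of members of [I]. *)
pose G : set B := [set x | exists a b, [/\ F a, I b & (a <= x `|` b)%O]].
have GP : proper_filter G.
  split=> [|[a [b [Fa Ib]]]|x y [a [b [Fa Ib ax]]] [a' [b' [Fa' Ib' ay]]]|
           x y xy [a [b [Fa Ib ax]]]].
  - by exists \top%O, \bot%O; split=> //; rewrite join1x.
  - rewrite join0x => ab; have : (F `&` I) a by split=> //; exact: IS ab _.
    by rewrite FI0.
  - exists (a `&` a')%O, (b `|` b')%O; split; [exact: FI|exact: IU|].
    rewrite joinIl lexI; apply/andP; split.
      by rewrite (le_trans (leIl _ _))// (le_trans ax)// leU2// leUl.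
    by rewrite (le_trans (leIr _ _))// (le_trans ay)// leU2// leUr.
  - by exists a, b; split=> //; rewrite (le_trans ax)// leU2.
have [u Gu] := proper_filter_extend GP; exists u => [x Fx|].
  by apply: Gu; exists x, \bot%O; split=> //; rewrite joinx0.
apply/seteqP; split=> // b [ub Ib].
have /Gu/ultC : G (~` b)%O by exists \top%O, b; split=> //; rewrite joinCx.
by apply.
Qed.

Lemma ideal_le b : ideal [set x | (x <= b)%O].
Proof.
split=> [|x y xb yb|x y xy yb] /=; first exact: le0x.
- by rewrite leUx; apply/andP.
- exact: le_trans yb.
Qed.

(** If [a <= b] failed, an ultrafilter would separate the principal filter of [a] from the principal
    ideal of [b]. *)
Lemma ult_le a b : (forall u, ult_set u a -> ult_set u b) -> (a <= b)%O.
Proof.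
move=> uab; apply: contrapT => nab.
have [||/=|u au ub] := @filter_ideal_separation
    [set x | (a <= x)%O] [set x | (x <= b)%O].
- split=> [|a0|x y ax ay|x y xy ax] /=; first exact: lex1.
  + by apply: nab; apply: le_trans a0 (le0x _).
  + by rewrite lexI; apply/andP.
  + exact: le_trans xy.
- exact: ideal_le.
- by apply/seteqP; split=> // x [/= ax xb]; apply: nab; exact: le_trans xb.
have : (ult_set u `&` [set x | (x <= b)%O]) b by split=> //=; apply/uab/au => /=.
by rewrite ub.
Qed.

Lemma open_stone_set a : open (stone_set a).
Proof.
by exists [set stone_set a]; [move=> _ ->; exists a|rewrite bigcup_set1].
Qed.

Lemma stone_set_nbhs (U : set (Ult B)) u : open U -> U u ->
  exists2 a, ult_set u a & stone_set a `<=` U.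
Proof.
move=> [D' DD <-] [V D'V Vu]; have [a _ aV] := DD _ D'V.
by exists a; [rewrite -aV in Vu|rewrite aV => x Vx; exists V].
Qed.

Lemma stone_setC a : stone_set (~` a)%O = ~` stone_set a.
Proof. by apply/seteqP; split=> u /ultC. Qed.

Lemma stone_setI a b : stone_set (a `&` b)%O = stone_set a `&` stone_set b.
Proof. by apply/seteqP; split=> u /ultI. Qed.

Lemma stone_ideal (U : set (Ult B)) : ideal [set a | stone_set a `<=` U].
Proof.
split=> [u /ult0//|a b aU bU u /ultU[/aU|/bU]//|a b ab bU u ua].
by apply/bU/ultS/ua.
Qed.

Lemma stone_filter (F : set (Ult B)) : F !=set0 ->
  proper_filter [set a | F `<=` stone_set a].
Proof.
move=> [v Fv]; split=> [u _|/(_ v Fv)/ult0//|a b Fa Fb u Fu|a b ab Fa u /Fa];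
  [exact: ultT| |exact: ultS].
by apply/ultI; split; [exact: Fa|exact: Fb].
Qed.

(** This takes the role of compactness of the Stone space. Without such an [a], some ultrafilter [u]
    contains all clopen sets around [F] and none inside [U]; closedness puts [u] in [F], hence in
    [U], where a basic neighbourhood gives a contradiction. *)
Lemma closed_open_stone_set (F U : set (Ult B)) : closed F -> F !=set0 ->
  open U -> F `<=` U -> exists2 a, F `<=` stone_set a & stone_set a `<=` U.
Proof.
move=> Fcl F0 Uop FU; apply: contrapT => na.
have [|u Fu uU] := filter_ideal_separation (stone_filter F0) (stone_ideal U).
  by apply/seteqP; split=> // a [Fa aU]; apply: na; exists a.
have /FU/(stone_set_nbhs Uop)[a ua aU] : F u.
  apply: contrapT => nFu.
  have [||a ua aF] := @stone_set_nbhs (~` F) u; [exact: closed_openC|by []|].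
  have /Fu/ultC : F `<=` stone_set (~` a)%O.
    by move=> v Fv; apply/ultC => va; exact: aF va Fv.
  by apply.
have : (ult_set u `&` [set a | stone_set a `<=` U]) a by [].
by rewrite uU.
Qed.

End Stone.

(** * The Vietoris hyperspace *)

Lemma vietoris_nbhs (X : topologicalType) (K : set (hyperspace X))
    (F : hyperspace X) : open K -> K F ->
  exists s : seq (set (hyperspace X)),
    [/\ forall W, W \in s -> vietoris_subbase W,
        forall W, W \in s -> W F &
        forall G, (forall W, W \in s -> W G) -> K G].
Proof.
move=> [D' DD <-] [V D'V VF]; have [A Asub AV] := DD _ D'V.
exists (finmap.enum_fset A); split=> [W /Asub|W WA|G GA].
- by rewrite inE.
- by move: VF; rewrite -AV; apply.
- by exists V => //; rewrite -AV.
Qed.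

(** * Clauses, compactness and the clause form of elements *)

Section Exponential.
Context {d : Order.disp_t} (B : ctbDistrLatticeType d).
Local Notation E := (exponential B).
Implicit Types (a b : B) (F : hyperspace (Ult B)) (p q : E).

Lemma hyperP F : closed (hyper_set F) /\ hyper_set F !=set0.
Proof. by case: F => F /= /asboolP. Qed.

Lemma hyper_stone_le F a b : (a <= b)%O -> F `<=` stone_set a -> F `<=` stone_set b.
Proof. by move=> ab Fa u /Fa; exact: ultS. Qed.

Lemma open_vietoris (V : set (hyperspace (Ult B))) :
  vietoris_subbase V -> open V.
Proof.
move=> Vsub; exists [set V]; last by rewrite bigcup_set1.
by move=> _ ->; exact: (@finI_from1 _ _ _ id).
Qed.

Lemma open_box a : open (vietoris_box (stone_set a)).
Proof.
by apply: open_vietoris; left; exists (stone_set a) => //; exact: open_stone_set.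
Qed.

Lemma open_diamond a : open (vietoris_diamond (stone_set a)).
Proof.
by apply: open_vietoris; right; exists (stone_set a) => //; exact: open_stone_set.
Qed.

Lemma vietoris_boxC a :
  ~` vietoris_box (stone_set a) = vietoris_diamond (stone_set (~` a)%O).
Proof.
apply/seteqP; split=> F /=.
  by move=> /existsNP[u /not_implyP[Fu nau]]; exists u; split=> //; exact/ultC.
by move=> [u [Fu /ultC nau]] Fa; exact: nau (Fa u Fu).
Qed.

Lemma clopen_box a : clopen_pred (vietoris_box (stone_set a)).
Proof.
apply/asboolP; split; first exact: open_box.
by rewrite -openC vietoris_boxC; exact: open_diamond.
Qed.

Lemma clopen_diamond a : clopen_pred (vietoris_diamond (stone_set a)).
Proof.
apply/asboolP; split; first exact: open_diamond.
by rewrite -openC -(complK a) -vietoris_boxC setCK; exact: open_box.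
Qed.

Definition box a : E := MkClop (clopen_box a).
Definition diamond a : E := MkClop (clopen_diamond a).

Lemma exp_leP p q : reflect (clop_set p `<=` clop_set q) (p <= q)%O.
Proof. by rewrite -subsetEset leEsub; exact: idP. Qed.

(* [(a, [:: b1; ..; bn])] stands for [[a] `&` ~` [~` b1] `&` .. `&` ~` [~` bn]]. *)
Definition clause (c : B * seq B) : E :=
  (box c.1 `&` \meet_(b <- c.2) diamond b)%O.

Lemma clauseP c F : clop_set (clause c) F <->
  F `<=` stone_set c.1 /\
  forall b, b \in c.2 -> hyper_set F `&` stone_set b !=set0.
Proof.
rewrite /clause; case: c => a s /=.
suff sP : clop_set (\meet_(b <- s) diamond b)%O F <->
    forall b, b \in s -> hyper_set F `&` stone_set b !=set0.
  by split=> [[Fa /sP]|[Fa /sP]].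
elim: s => [|b s IH]; first by rewrite big_nil; split.
rewrite big_cons; split=> [[bF /IH sF] c /predU1P[->//|/sF]//|sF].
split; first by apply: sF; rewrite mem_head.
by apply/IH => c cs; apply: sF; rewrite inE cs orbT.
Qed.

(** A subbasic box shrinks to the box of a clopen set by [closed_open_stone_set], a diamond to that
    of a clopen neighbourhood of a point where [F] meets it. *)
Lemma clause_nbhs (K : set (hyperspace (Ult B))) F : open K -> K F ->
  exists2 c, clop_set (clause c) F & clop_set (clause c) `<=` K.
Proof.
move=> Kop KF; have [s [Asub VF sK]] := vietoris_nbhs Kop KF.
suff [c cF cA] : exists2 c, clop_set (clause c) F &
    forall W, W \in s -> clop_set (clause c) `<=` W.
  by exists c => // G cG; apply: sK => W Ws; exact: cA cG.
elim: s {sK} Asub VF => [_ _|W s IH Asub VF].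
  by exists (\top%O, [::]) => //; apply/clauseP; split=> //= u _; exact: ultT.
have [||[a bs] /clauseP[Fa Fbs] sub] := IH.
- by move=> V' sV'; apply: Asub; rewrite inE sV' orbT.
- by move=> V' sV'; apply: VF; rewrite inE sV' orbT.
have := VF W (mem_head _ _).
have [[U Uop <-] FU|[U Uop <-] [u [Fu Uu]]] := Asub W (mem_head _ _).
  have [Fcl F0] := hyperP F.
  have [a' Fa' a'U] := closed_open_stone_set Fcl F0 Uop FU.
  exists ((a `&` a')%O, bs).
    by apply/clauseP; rewrite /= stone_setI; split=> // u Fu; split; [exact: Fa|exact: Fa'].
  move=> V' /predU1P[->|/sub sV' G /clauseP[/= Ga Gbs]].
    by move=> G /clauseP[/= Ga _] u /Ga; rewrite stone_setI => -[_ /a'U].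
  by apply/sV'/clauseP; split=> //= u /Ga; rewrite stone_setI => -[].
have [b ub bU] := stone_set_nbhs Uop Uu.
exists (a, b :: bs).
  apply/clauseP; split=> //= b' /predU1P[->|/Fbs//]; by exists u.
move=> V' /predU1P[->|/sub sV' G /clauseP[/= Ga Gbs]].
  move=> G /clauseP[_ /(_ b (mem_head _ _))[v [Gv bv]]].
  by exists v; split=> //; exact: bU.
by apply/sV'/clauseP; split=> //= b' b's; apply: Gbs; rewrite inE b's orbT.
Qed.

(** An ultrafilter [U] converges to the closed set [L] of the points lying in every clopen set whose
    box belongs to [U]. *)
Lemma hyperspace_compact : compact [set: hyperspace (Ult B)].
Proof.
rewrite compact_ultra => U UU _.
pose phi := [set a | U (vietoris_box (stone_set a))].
have phiP : proper_filter phi.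
  split=> [|U0|a b Ua Ub|a b ab].
  - by apply: filterS filterT => F _ u _; exact: ultT.
  - have [F F0] := filter_ex U0; have [_ [u Fu]] := hyperP F.
    exact: (@ult0 _ _ u (F0 u Fu)).
  - apply: filterS (filterI Ua Ub) => F [Fa Fb] u Fu.
    by apply/ultI; split; [exact: Fa|exact: Fb].
  - by apply: filterS => F; exact: hyper_stone_le.
pose L := [set u : Ult B | phi `<=` u].
have Lcl : closed L.
  rewrite -openC openE => u /existsNP[a /not_implyP[pa /ultC ua]].
  rewrite /interior nbhsE; exists (stone_set (~` a)%O).
    by split=> //; exact: open_stone_set.
  by move=> v /ultC va Lv; exact/va/Lv.
have L0 : L !=set0 by have [u] := proper_filter_extend phiP; exists u.
have LP : `[< closed L /\ L !=set0 >] by exact/asboolP.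
pose F := MkHyperspace LP.
(* A proper filter is the intersection of the ultrafilters above it; this places the box part of a
   clause around [L] in [U]. *)
have phiL a : L `<=` stone_set a -> phi a.
  move=> La; apply: contrapT => npa.
  have [|||u Lu ua] := @filter_ideal_separation _ _ phi [set x | (x <= a)%O].
  - exact: phiP.
  - exact: ideal_le.
  - apply/seteqP; split=> // x [px /= xa]; apply: npa.
    by have [_ _ _] := phiP; apply; first exact: xa.
  have : (ult_set u `&` [set x | (x <= a)%O]) a by split=> //=; exact: La.
  by rewrite ua.
exists F; split=> //= N; rewrite nbhsE => -[K [Kop KF] KN].
have [[a bs] cF cK] := clause_nbhs Kop KF.
apply: (filterS (P := clop_set (clause (a, bs)))); first exact: subset_trans cK KN.
have [/= Fa Fbs] := (clauseP _ _).1 cF; apply: filterI; first exact: phiL.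
elim: bs Fbs {cF cK} => [_|b bs IH Fbs]; first by rewrite big_nil; exact: filterT.
rewrite big_cons; apply: filterI; last first.
  by apply: IH => b' b's; apply: Fbs; rewrite inE b's orbT.
(* Were the diamond of [b] not in [U], the box of its complement would be, and [L] would avoid
   [b]. *)
have [//|] := in_ultra_setVsetC (vietoris_diamond (stone_set b)) UU.
rewrite -{1}(complK b) -vietoris_boxC setCK => pb.
have [u [Lu ub]] := Fbs b (mem_head _ _).
by have /ultC := Lu _ pb.
Qed.

(** If no finite join of clauses below [p] equals [p], the differences [W] generate a proper filter,
    which clusters at some [F] in [p] by compactness. A clause around [F] inside [p] is itself such
    a join, so [F] cannot be a cluster point. *)
Lemma exp_clauses p : exists s, p = (\join_(c <- s) clause c)%O.
Proof.
have /asboolP[pop pcl] : clopen_pred (clop_set p) by case: p.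
have pcomp : compact (clop_set p) by exact: subclosed_compact hyperspace_compact _.
pose D := [set s : seq (B * seq B) | (\join_(c <- s) clause c <= p)%O].
pose W (s : seq (B * seq B)) := clop_set p `\` clop_set (\join_(c <- s) clause c)%O.
apply: contrapT => /forallNP np.
have WP : ProperFilter (filter_from D W).
  apply: filter_from_proper => [|s sp].
    apply: filter_from_filter => [|s s' sp s'p].
      by exists [::]; rewrite /D /= big_nil le0x.
    exists (s ++ s'); first by rewrite /D /= big_cat leUx; apply/andP.
    rewrite /W big_cat => F [pF ss'F].
    by split; split=> // sF; apply: ss'F; [left|right].
  apply: contrapT => W0; apply: (np s); apply: le_anti; rewrite sp andbT.
  by apply/exp_leP => F pF; apply: contrapT => sF; apply: W0; exists F.
have [F [pF clF]] : clop_set p `&` cluster (filter_from D W) !=set0.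
  apply: pcomp; exists [::]; last by move=> F [].
  by rewrite /D /= big_nil le0x.
have [c cF cp] := clause_nbhs pop pF.
have [||G [[_ +] cG]] := clF (W [:: c]) (clop_set (clause c)).
- by exists [:: c] => //; rewrite /D /= big_seq1; apply/exp_leP.
- apply: open_nbhs_nbhs; split=> //.
  by case: (clause c) => K /= /asboolP[].
by rewrite big_seq1.
Qed.

End Exponential.

(** * Interpolation *)

Section JoinsOfMeets.
Context {d : Order.disp_t} {L : tbLatticeType d}.
Implicit Types (X Y : set L) (s P Q : seq L).

Definition joins s : L := (\join_(x <- s) x)%O.
Definition meets s : L := (\meet_(x <- s) x)%O.
Definition joins_of_meets X : set L := joins @` seqs (meets @` seqs X).

Lemma sub_seqs (T : eqType) (A B : set T) : A `<=` B -> seqs A `<=` seqs B.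
Proof. by move=> AB s sA x /sA/AB. Qed.

Lemma seqs_cons (T : eqType) (A : set T) x (s : seq T) :
  A x -> seqs A s -> seqs A (x :: s).
Proof. by move=> Ax sA y /predU1P[->|ys]; [|exact: sA]. Qed.

Lemma sub_joins_of_meets X Y : X `<=` Y -> joins_of_meets X `<=` joins_of_meets Y.
Proof. by move=> XY; do 2![apply: image_subset; apply: sub_seqs]. Qed.

Lemma card_lt_joins_of_meets (V : Type) X : infinite_set [set: V] ->
  card_lt X [set: V] -> card_lt (joins_of_meets X) [set: V].
Proof.
move=> Vinf Xlt; do 2?[apply: card_lt_seqs => //].
- by move=> s s' ss'; apply: eq_big_idem => //; exact: joinxx.
- by move=> s s' ss'; apply: eq_big_idem => //; exact: meetxx.
Qed.

(** For fixed [x] the interpolants are met over [Q]; the results are then joined over [P]. *)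
Lemma interpolate_joins_meets X P Q :
  (forall x y, x \in P -> y \in Q -> exists2 r, X r & (x <= r <= y)%O) ->
  exists2 r, joins_of_meets X r & (joins P <= r <= meets Q)%O.
Proof.
move=> XPQ.
have meetP x : x \in P ->
    exists2 r, (meets @` seqs X) r & (x <= r <= meets Q)%O.
  move=> /XPQ {XPQ}; elim: Q => [_|y Q IH xX].
    exists \top%O; last by rewrite /meets big_nil lex1 lexx.
    by exists [::]; [|rewrite /meets big_nil].
  have [y' y'Q|_ [s sX <-] /andP[xs sQ]] := IH.
    by apply: xX; rewrite inE y'Q orbT.
  have [r Xr /andP[xr ry]] := xX _ (mem_head _ _).
  exists (meets (r :: s)); first by exists (r :: s) => //; exact: seqs_cons.
  by rewrite /meets !big_cons lexI xr xs leI2.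
elim: P meetP {XPQ} => [_|x P IH xX].
  exists \bot%O; last by rewrite /joins big_nil !le0x.
  by exists [::]; [|rewrite /joins big_nil].
have [x' x'P|_ [s sX <-] /andP[xs sQ]] := IH.
  by apply: xX; rewrite inE x'P orbT.
have [r Xr /andP[xr ry]] := xX _ (mem_head _ _).
exists (joins (r :: s)); first by exists (r :: s) => //; exact: seqs_cons.
rewrite /joins !big_cons; apply/andP; split; first exact: leU2.
by rewrite leUx ry.
Qed.

End JoinsOfMeets.

Section Interpolation.
Context {d : Order.disp_t} (B : ctbDistrLatticeType d).
Local Notation E := (exponential B).
Implicit Types (a b : B) (c : B * seq B) (p q : E).

Lemma exp_leC p q : (p <= ~` q)%O <->
  forall F : hyperspace (Ult B), clop_set p F -> ~ clop_set q F.
Proof. by split=> [/exp_leP|pq]; [|apply/exp_leP]. Qed.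

(** A closed set satisfying the clause lies in [c.1], so only the part of each [b] inside [c.1]
    matters; cutting down lets disjointness of clauses be witnessed by one inequality between single
    labels. *)
Definition labels c : seq B := c.1 :: [seq (c.1 `&` b)%O | b <- c.2].

(* If none of the labels works, then the closed set [stone_set (c.1 `&` c'.1)]
   is nonempty and satisfies both clauses. *)
Lemma clause_disjoint_labels c c' : (clause c <= ~` clause c')%O ->
  exists a b (h : B -> E),
    [/\ a \in labels c, b \in labels c', (a <= ~` b)%O,
        h = @box _ B \/ h = @diamond _ B &
        forall r, (a <= r <= ~` b)%O -> (clause c <= h r <= ~` clause c')%O].
Proof.
case: c c' => [a bs] [a' bs'] cc'.
(* A set satisfying the first clause has a point in both [a] and [b], here outside [a']: this case
   calls for a diamond. *)
have [[b bbs ab]|nbs] := pselect (exists2 b, b \in bs & (a `&` b <= ~` a')%O).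
  exists (a `&` b)%O, a', (@diamond _ B); split=> //; [|exact: mem_head|by right|].
    by rewrite inE map_f ?orbT.
  move=> r /andP[abr ra']; apply/andP; split; [apply/exp_leP => F|apply/exp_leC => F].
    move=> /clauseP[/= Fa /(_ b bbs)[u [Fu ub]]]; exists u; split=> //.
    by apply: ultS abr _; apply/ultI; split=> //; exact: Fa.
  move=> [u [Fu /(ultS ra')/ultC ua']] /clauseP[/= Fa' _].
  exact/ua'/Fa'.
(* The remaining inequalities have [a] itself on the left and are interpolated by boxes. *)
suff [x [xa' ax xF]] : exists x, [/\ x \in labels (a', bs'), (a <= ~` x)%O &
    forall F : hyperspace (Ult B), F `<=` stone_set (~` x)%O ->
      ~ clop_set (clause (a', bs')) F].
  exists a, x, (@box _ B); split=> //; [exact: mem_head|by left|].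
  move=> r /andP[ar rx]; apply/andP; split; [apply/exp_leP => F|apply/exp_leC => F].
    by move=> /clauseP[/= Fa _]; exact: hyper_stone_le Fa.
  by move=> /(hyper_stone_le rx) Fx; exact: xF.
have [[b bbs ab]|nbs'] := pselect (exists2 b, b \in bs' & (a <= ~` (a' `&` b))%O).
  exists (a' `&` b)%O; split=> //; first by rewrite inE map_f ?orbT.
  move=> F Fab /clauseP[/= Fa' /(_ b bbs)[u [Fu ub]]].
  by have /ultC := Fab u Fu; apply; apply/ultI; split=> //; exact: Fa'.
have [aa'|naa'] := pselect (a <= ~` a')%O.
  exists a'; split=> //; first exact: mem_head.
  (* A member of the hyperspace inside both [a'] and its complement would be empty. *)
  move=> F Fna' /clauseP[/= Fa' _]; have [_ [u Fu]] := hyperP F.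
  by have /ultC := Fna' u Fu; apply; exact: Fa'.
exfalso.
have meets_stone x y : ~ (x <= ~` y)%O -> exists2 u : Ult B, ult_set u x & ult_set u y.
  move=> nxy; apply: contrapT => nu; apply: nxy; apply: ult_le => u ux.
  by apply/ultC => uy; apply: nu; exists u.
have clF : closed (stone_set (a `&` a')%O).
  by rewrite -openC -stone_setC; exact: open_stone_set.
have F0 : stone_set (a `&` a')%O !=set0.
  by have [u ua ua'] := meets_stone _ _ naa'; exists u; rewrite stone_setI.
have FP : `[< closed (stone_set (a `&` a')%O) /\ stone_set (a `&` a')%O !=set0 >].
  exact/asboolP.
have /exp_leC/(_ (MkHyperspace FP)) := cc'; apply; apply/clauseP; split => /=.
- by rewrite stone_setI; exact: subIsetl.
- move=> b bbs; have [|u /ultI[ua ub] ua'] := @meets_stone (a `&` b)%O a'.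
    by move=> ab; apply: nbs; exists b.
  by exists u; rewrite stone_setI.
- by rewrite stone_setI; exact: subIsetr.
- move=> b bbs; have [|u ua /ultI[ua' ub]] := @meets_stone a (a' `&` b)%O.
    by move=> ab; apply: nbs'; exists b.
  by exists u; rewrite stone_setI.
Qed.

(* Both the disjunctive form [D p] and the dual of [D (~` p)] contribute labels,
   since [p] serves as lower and as upper bound. *)
Definition exp_map (D : E -> seq (B * seq B)) (f : B -> set B) p : set E :=
  joins_of_meets (\bigcup_(t in
      [set` flatten [seq labels c | c <- D p] ++
            [seq (~` a)%O | a <- flatten [seq labels c | c <- D (~` p)%O]]])
    (@box _ B @` f t `|` @diamond _ B @` f t)).

Lemma card_lt_exp_map (V : Type) D f p : infinite_set [set: V] ->
  (forall a, card_lt (f a) [set: V]) -> card_lt (exp_map D f p) [set: V].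
Proof.
move=> Vinf flt; apply: card_lt_joins_of_meets => //.
apply: card_lt_bigcup => // t; apply: card_lt_setU => //;
  exact: card_lt_le (card_image_le _ _) (flt t).
Qed.

(** The clauses of [p] present it as a join, and those of its dual present [q] as a meet of
    complements; labels of the former feed [f], complemented labels of the latter feed [g]. *)
Lemma exp_map_interpolate D f g :
  (forall p, p = \join_(c <- D p) clause c)%O ->
  (forall a b, (a <= b)%O -> exists2 r, (f a `&` g b) r & (a <= r <= b)%O) ->
  forall p q, (p <= q)%O ->
    exists2 r, (exp_map D f p `&` exp_map D g q) r & (p <= r <= q)%O.
Proof.
move=> DE fg p q pq; rewrite /exp_map.
set X := \bigcup_(t in _) _; set Y := \bigcup_(t in _) _.
(* Interpolating within the intersection of [X] and [Y] yields one element that lies in both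
   closures by monotonicity. *)
have [|r XYr prq] := @interpolate_joins_meets _ _ (X `&` Y)
    [seq clause c | c <- D p] [seq (~` clause c)%O | c <- D (~` q)%O].
  move=> _ _ /mapP[c cp ->] /mapP[c' cq ->].
  have cc' : (clause c <= ~` clause c')%O.
    have cp' : (clause c <= p)%O by rewrite (DE p); exact: joins_sup_seq.
    have cq' : (clause c' <= ~` q)%O by rewrite (DE (~` q)%O); exact: joins_sup_seq.
    by rewrite (le_trans cp')// (le_trans pq)// -(complK q) leC.
  have [a [b [h [ac bc ab hE hP]]]] := clause_disjoint_labels cc'.
  have [r [far gbr] arb] := fg _ _ ab.
  exists (h r); last exact: hP.
  split.
    exists a; last by case: hE => ->; [left|right]; exists r.
    by rewrite /= mem_cat; apply/orP; left; apply/flatten_mapP; exists c.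
  exists (~` b)%O; last by case: hE => ->; [left|right]; exists r.
  by rewrite /= mem_cat; apply/orP; right; apply/map_f/flatten_mapP; exists c'.
exists r; first by split; apply: sub_joins_of_meets XYr; [exact: subIsetl|exact: subIsetr].
move: prq; rewrite /joins /meets !big_map -DE; congr (_ && (_ <= _)%O).
by rewrite -compl_joins -DE complK.
Qed.

End Interpolation.

Theorem theorem2p9 (lambda kappa : Type)
    (inf_lambda : infinite_set [set: lambda])
    (inf_kappa : infinite_set [set: kappa])
    (le_kappa_lambda : [set: kappa] #<= [set: lambda])
    (d : Order.disp_t) (B : ctbDistrLatticeType d) :
  has_FN lambda kappa B -> has_FN lambda kappa (exponential B).
Proof.
move=> [f [g [flt glt fg]]].
have /choice[D DE] := @exp_clauses _ B.
exists (exp_map D f), (exp_map D g); split=> [p|p|p q pq].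
- exact: card_lt_exp_map.
- exact: card_lt_exp_map.
(* The second half is the first with [f] and [g] exchanged. *)
- by split; apply: exp_map_interpolate pq => // a b /fg[].
Qed.
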